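(* Consider a Cayley-Klein space of dimension $n$ given by $Q_0,A_1,Q_1,\dots,A_r,Q_r,A_{r+1}=\varnothing$ (with $A_0=P^n(\mathbb{R})$). Let $K$ be a subspace of $P^n(\mathbb{R})$ satisfying $K\cap A_l\neq\varnothing$ and $K\cap A_{l+1}=\varnothing$ for an integer $l$ with $0\le l\le r$. Then $K$ has a unique total polar, namely $(K\cap A_l)^{p_l}$, if and only if $K$ is a regular subspace.
   Context: Conventions. Subspaces are projective subspaces, including $\varnothing$ (of dimension $-1$) and the whole space; $\dim$ is projective dimension; $S+T$ is the smallest subspace containing $S$ and $T$; a point $X$ is identified with $\{X\}$. A hyperplane of a subspace $S$ is a subspace of $S$ of dimension $\dim S-1$. A set of points is independent if representing vectors are linearly independent; a set of hyperplanes is independent if the linear forms defining them are linearly independent. The intersection of the empty family of hyperplanes is the whole space. Quadrics. A quadric $Q$ in a real projective space $P(V)$ is the set $\{[x] : f(x,x)=0\}$ for a symmetric bilinear form $f$ on $V$ that is not identically zero; it is considered together with $f$. Points $[x],[y]$ are conjugate with respect to $Q$ if $f(x,y)=0$. The polar of a subspace $K$ with respect to $Q$ is the set of all points of $P(V)$ conjugate to every point of $K$. The vertex of $Q$ is the polar of $P(V)$; $Q$ is non-degenerate if its vertex is empty. Cayley-Klein space. Put $A_0=P^n(\mathbb{R})$. A Cayley-Klein space of dimension $n$ is $P^n(\mathbb{R})$ with a sequence $Q_0,A_1,Q_1,A_2,\dots,A_r,Q_r,A_{r+1}=\varnothing$ such that, for $0\le i\le r$, $Q_i$ is a quadric in $A_i$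 with vertex $A_{i+1}$. Its absolute figure is the sequence of complex extensions $\hat Q_0\supseteq\hat A_1\supseteq\hat Q_1\supseteq\cdots\supseteq\hat A_r\supseteq\hat Q_r\supseteq\hat A_{r+1}=\varnothing$. For a subspace $K$ of $P^n(\mathbb{R})$, $(K\cap A_j)^{p_j}\subseteq A_j$ denotes the polar of $K\cap A_j$ with respect to the quadric $Q_j$ in $A_j$. Total polars. If $X$ is a point with $X\in A_l\setminus A_{l+1}$, a total polar of $X$ is a hyperplane of $P^n(\mathbb{R})$ containing $X^{p_l}$ (the polar of $X$ in $A_l$ with respect to $Q_l$). If $K$ is a $k$-dimensional subspace, a total polar of $K$ is an $(n-k-1)$-dimensional subspace of the form $\bigcap_{i=0}^k H_i$, where $\{X_0,\dots,X_k\}$ is some independent subset $B$ of $K$ with $|B\cap A_j|=\dim(K\cap A_j)+1$ for $0\le j\le r$, each $H_i$ is a total polar of $X_i$, and $\{H_0,\dots,H_k\}$ is independent. ($P^n(\mathbb{R})$ and $\varnothing$ are total polar to each other.) Regular subspace. A subspace $K$ with $K\cap A_l\ne\varnothing$ and $K\cap A_{l+1}=\varnothing$ ($0\le l\le r$) is called regular if $K+A_l=P^n(\mathbb{R})$. *)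

(* Defs.v *)
From mathcomp Require Import all_boot all_algebra.
From mathcomp Require Import reals.

Set Implicit Arguments.
Unset Strict Implicit.
Unset Printing Implicit Defensive.

Import GRing.Theory.
Local Open Scope ring_scope.

(* The projective subspaces of P(V) are represented by the linear subspaces
   {vspace V}, so that the projective dimension of U is \dim U - 1, the empty
   subspace is 0%VS and the intersection and join are :&: and +.  A point is
   represented by a nonzero vector or by the line it spans. *)

(* The point set {[x] : f(x,x) = 0} is determined by the form and does not need
   a separate field. *)
Record quadric (R : realType) (V : vectType R) (U : {vspace V}) := Quadric {
  qform :> {symmetric (subvs_of U)};
  qform_neq0 : exists u v, qform u v != 0
}.

(* The preimage of K under the inclusion of U in V is K :&: U, so this is the
   polar, inside U, of K :&: U. *)
Definition polar (R : realType) (V : vectType R) (U : {vspace V})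
    (Q : quadric U) (K : {vspace V}) : {vspace V} :=
  (linfun vsval @: orthov (qform Q) (linfun vsval @^-1: K))%VS.

Lemma polarP (R : realType) (V : vectType R) (U : {vspace V})
    (Q : quadric U) (K : {vspace V}) (x : V) :
  x \in polar Q K <->
  x \in U /\ forall y, y \in U -> y \in K -> Q (vsproj U x) (vsproj U y) = 0.
Proof.
split=> [/memv_imgP[u /mem_orthovP ou ->]|[xU ox]].
  rewrite lfunE /=; split=> [|y yU yK]; first exact: subvsP.
  by rewrite vsvalK; apply: ou; rewrite -memv_preim lfunE /= vsprojK.
apply/memv_imgP; exists (vsproj U x); last by rewrite lfunE /= vsprojK.
apply/mem_orthovP=> v; rewrite -memv_preim lfunE /= => vK.
by rewrite -[v]vsvalK; apply: ox vK; apply: subvsP.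
Qed.

Definition vertex (R : realType) (V : vectType R) (U : {vspace V})
    (Q : quadric U) : {vspace V} := polar Q U.

(* Only the subspaces ckA 0, ..., ckA r.+1 are meaningful. *)
Record cayley_klein (R : realType) (n r : nat) := CayleyKlein {
  ckA : nat -> {vspace 'rV[R]_n.+1};
  ckQ : forall i : 'I_r.+1, quadric (ckA i);
  ckA_first : ckA 0 = fullv;
  ckA_vertex : forall i : 'I_r.+1, vertex (ckQ i) = ckA i.+1;
  ckA_last : ckA r.+1 = 0%VS
}.

(* The total polars H of the point represented by x. *)
Definition point_total_polar (R : realType) (n r : nat)
    (C : cayley_klein R n r) (x : 'rV[R]_n.+1) (H : {vspace 'rV[R]_n.+1}) :
    Prop :=
  \dim H = n /\
  exists l : 'I_r.+1, [/\ x \in ckA C l, x \notin ckA C l.+1 &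
                          (polar (ckQ C l) <[x]> <= H)%VS].

Definition independent_hyperplanes (R : realType) (V : vectType R) (m : nat)
    (H : 'I_m -> {vspace V}) : Prop :=
  exists phi : m.-tuple 'Hom(V, R^o),
    free phi /\ forall i, H i = lker (tnth phi i).

(* With \dim K = k + 1, the linear dimension of an (n-k-1)-dimensional
   projective subspace is n + 1 - \dim K.  The tuple B lists representing
   vectors of the points X_0, ..., X_k. *)
Definition total_polar (R : realType) (n r : nat) (C : cayley_klein R n r)
    (K T : {vspace 'rV[R]_n.+1}) : Prop :=
  [\/ K = fullv /\ T = 0%VS, K = 0%VS /\ T = fullv |
      (\dim T = n.+1 - \dim K)%N /\
      exists (B : (\dim K).-tuple 'rV[R]_n.+1)
             (H : 'I_(\dim K) -> {vspace 'rV[R]_n.+1}),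
        [/\ free B /\ (forall i, tnth B i \in K),
            forall j : 'I_r.+1,
              #|[set i | tnth B i \in ckA C j]| = \dim (K :&: ckA C j),
            forall i, point_total_polar C (tnth B i) (H i),
            independent_hyperplanes H &
            T = (\bigcap_(i < \dim K) H i)%VS]].

Definition regular (R : realType) (n r : nat) (C : cayley_klein R n r)
    (K : {vspace 'rV[R]_n.+1}) : Prop :=
  exists l : 'I_r.+1, [/\ (K :&: ckA C l)%VS != 0%VS,
                          (K :&: ckA C l.+1)%VS = 0%VS &
                          (K + ckA C l)%VS = fullv].

(* Main.v *)
(* Choose a basis x_i of K adapted to the flag of the A_j, and let m_i be the
   index with x_i in A_(m_i) but not in A_(m_i + 1).  Any linear form phi_i on
   the whole space that extends Q_(m_i)(x_i, -) has for kernel a total polar of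
   x_i.  It vanishes on A_(m_i + 1), so the phi_i are triangular with respect to
   the flag, hence independent: total polars always exist.

   Every total polar contains the polar P of K :&: A_l, and
   \dim P = \dim (K + A_l) - \dim K, so if K is regular the dimensions agree and
   P is the only total polar.  If K is not regular, the total polar T cut out by
   the phi_i does not lie in A_l, because T :&: A_l is contained in P, which is
   too small.  Adding to some phi_i with m_i = l a form that vanishes on A_l but
   not on T then gives another total polar. *)
Require Import Defs.
From HB Require Import structures.
From mathcomp Require Import all_boot all_algebra.
From mathcomp Require Import reals.

Set Implicit Arguments.
Unset Strict Implicit.
Unset Printing Implicit Defensive.

Import GRing.Theory.
Local Open Scope ring_scope.

(** * Linear forms and the dimension of their common kernel *)

Lemma separating_form (F : fieldType) (V : vectType F) (A : {vspace V}) (t : V) :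
  t \notin A -> exists2 psi : 'Hom(V, F^o), (A <= lker psi)%VS & psi t != 0.
Proof.
move=> tA; pose u := t - projv A t.
have u0 : u != 0.
  by apply: contraNneq tA => /eqP; rewrite subr_eq0 => /eqP ->; exact: memv_proj.
pose c i : 'Hom(V, F^o) := linfun (coord (vbasis {:V}) i : V -> F^o).
have [i ci|c0] := pickP (fun i => c i u != 0); last first.
  case/eqP: u0; rewrite (coord_vbasis (memvf u)) big1 // => i _.
  by have /eqP := c0 i; rewrite lfunE /= => ->; rewrite scale0r.
exists (c i \o (\1 - projv A))%VF.
  apply/subvP => x xA.
  by rewrite memv_ker comp_lfunE add_lfunE opp_lfunE id_lfunE projv_id // subrr linear0.
by rewrite comp_lfunE add_lfunE opp_lfunE id_lfunE.
Qed.

(** Rank-nullity on [U] for the map [f] into row vectors whose entries are the forms. Independence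
    on [U] makes [f] map [U] onto the whole space. *)
Lemma dim_bigcap_lker (F : fieldType) (V : vectType F) (U : {vspace V}) (m : nat)
    (phi : 'I_m -> 'Hom(V, F^o)) :
  (forall c : 'I_m -> F,
     {in U, forall y, \sum_i c i * phi i y = 0} -> forall i, c i = 0) ->
  (\dim (U :&: \bigcap_(i < m) lker (phi i)) + m = \dim U)%N.
Proof.
move=> indep.
pose g y := \row_i phi i y : 'rV[F]_m.
have lin_g : linear g by move=> a x y; apply/rowP => i; rewrite !mxE linearP.
pose gL : {linear V -> 'rV[F]_m} :=
  HB.pack g (GRing.isLinear.Build _ _ _ _ g lin_g).
pose f := linfun gL.
have fE y : f y = \row_i phi i y by rewrite lfunE.
have -> : (\bigcap_(i < m) lker (phi i))%VS = lker f.
  apply/vspaceP => y; rewrite memv_ker fE; apply/idP/eqP => [yk|/rowP yk].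
    apply/rowP => i; rewrite !mxE; apply/eqP.
    have : y \in lker (phi i) by apply: subvP yk; exact: (@bigcapv_inf _ _ _ i).
    by rewrite memv_ker.
  rewrite -[y \in _]/(<[y]> <= _)%VS.
  apply/subv_bigcapP => i _; rewrite -memvE memv_ker.
  by have := yk i; rewrite !mxE => ->.
rewrite -(limg_ker_dim f U); congr (_ + _)%N.
suff -> : (f @: U)%VS = fullv by rewrite dimvf /dim /= mul1n.
(* A form [psi] vanishing on the image of [U] is a linear relation on [U] among the [phi i], with
   coefficients [psi (delta_mx 0 i)]. *)
apply/vspaceP => w; rewrite memvf; apply/negPn/negP => wU.
have [psi /subvP psiU /eqP []] := separating_form wU.
have psiE v : psi v = \sum_i v 0 i *: psi (delta_mx 0 i).
  rewrite {1}(row_sum_delta v) linear_sum.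
  by apply: eq_bigr => i _; rewrite linearZ.
have psi0 i : psi (delta_mx 0 i) = 0.
  apply: (indep (fun i => psi (delta_mx 0 i))) => y yU.
  have /eqP fy0 : psi (f y) == 0 by rewrite -memv_ker psiU // memv_img.
  rewrite -[RHS]fy0 psiE fE.
  by apply: eq_bigr => j _; rewrite mxE; apply: mulrC.
by rewrite psiE big1 // => i _; rewrite psi0 scaler0.
Qed.

(** * Polars with respect to a quadric, and their dimension *)

(** The projection [vsproj U] extends the form from [U] to all of [V], so that its kernel is a
    subspace of [V]. On [U] it is conjugacy with [x], for [x] in [U]. *)
Definition polar_form (R : realType) (V : vectType R) (U : {vspace V})
    (Q : quadric U) (x : V) : 'Hom(V, R^o) :=
  (linfun (qform Q (vsproj U x) : subvs_of U -> R^o) \o linfun (vsproj U))%VF.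

Lemma polar_formE (R : realType) (V : vectType R) (U : {vspace V})
    (Q : quadric U) (x y : V) :
  polar_form Q x y = Q (vsproj U x) (vsproj U y).
Proof. by rewrite comp_lfunE !lfunE. Qed.

Lemma polar_form_sym (R : realType) (V : vectType R) (U : {vspace V})
    (Q : quadric U) (x y : V) : polar_form Q x y = polar_form Q y x.
Proof. by rewrite !polar_formE hermC expr0 mul1r. Qed.

Lemma polar_form_sum (R : realType) (V : vectType R) (U : {vspace V})
    (Q : quadric U) (I : finType) (c : I -> R) (x : I -> V) (y : V) :
  polar_form Q (\sum_i c i *: x i) y = \sum_i c i * polar_form Q (x i) y.
Proof.
rewrite polar_form_sym linear_sum; apply: eq_bigr => i _.
by rewrite linearZ /= polar_form_sym.
Qed.

Lemma mem_polar (R : realType) (V : vectType R) (U : {vspace V})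
    (Q : quadric U) (K : {vspace V}) (x : V) :
  x \in polar Q K <->
  x \in U /\ {in (U :&: K)%VS, forall y, polar_form Q y x = 0}.
Proof.
apply: (iff_trans (polarP Q K x)); split=> -[xU xK]; split=> //.
  by move=> y /memv_capP[yU yK]; rewrite polar_form_sym polar_formE; exact: xK.
by move=> y yU yK; rewrite -polar_formE polar_form_sym xK // memv_cap yU.
Qed.

Lemma mem_vertex (R : realType) (V : vectType R) (U : {vspace V})
    (Q : quadric U) (x : V) :
  x \in vertex Q <-> x \in U /\ {in U, forall y, polar_form Q y x = 0}.
Proof. by have := mem_polar Q U x; rewrite capvv. Qed.

(** The polar is cut out in [U] by the forms of a basis of [W]. A relation on [U] among them puts a
    vector of [W] in the vertex, so they are independent there. *)
Lemma dim_polar (R : realType) (V : vectType R) (U : {vspace V})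
    (Q : quadric U) (W : {vspace V}) :
  (W <= U)%VS -> (W :&: vertex Q = 0)%VS ->
  (\dim (polar Q W) + \dim W = \dim U)%N.
Proof.
move=> WU W0; pose phi (i : 'I_(\dim W)) := polar_form Q (vbasis W)`_i.
have sumE (c : 'I_(\dim W) -> R) y :
    \sum_i c i * phi i y = polar_form Q (\sum_i c i *: (vbasis W)`_i) y.
  by rewrite polar_form_sum.
have memb (i : 'I_(\dim W)) : (vbasis W)`_i \in W.
  by apply: vbasis_mem; rewrite mem_nth // size_tuple.
rewrite -(@dim_bigcap_lker _ _ U _ phi) => [|c c0]; last first.
  have /freeP := basis_free (vbasisP W); apply; apply/eqP.
  rewrite -memv0 -W0 memv_cap memv_suml => [|i _]; last exact: rpredZ.
  apply/mem_vertex; split=> [|y yU].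
    by apply: (subvP WU); rewrite memv_suml // => i _; exact: rpredZ.
  by rewrite polar_form_sym -sumE c0.
congr (\dim _ + _)%N; apply/vspaceP => x; rewrite memv_cap.
apply/idP/andP => [/mem_polar[xU xW]|[xU xk]].
  split=> //; rewrite -[x \in _]/(<[x]> <= _)%VS.
  apply/subv_bigcapP => i _; rewrite -memvE memv_ker xW //.
  by rewrite (capv_idPr WU).
apply/mem_polar; split=> // y; rewrite (capv_idPr WU) => yW.
rewrite (coord_vbasis yW) -sumE big1 // => i _.
suff /eqP -> : phi i x == 0 by rewrite mulr0.
by rewrite -memv_ker; apply: subvP xk; exact: (@bigcapv_inf _ _ _ i).
Qed.

(** * Bases adapted to a flag *)

(** Induction along the flag: a basis adapted from [A 1] on is completed by a basis of a complement
    [D] of [K :&: A 1] in [K :&: A 0]. No vector of the latter lies in [A 1], so the later counts do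
    not change. *)
Lemma adapted_basis (F : fieldType) (V : vectType F) (A : nat -> {vspace V})
    (K : {vspace V}) (r : nat) :
  (forall i j, (i <= j <= r)%N -> (A j <= A i)%VS) ->
  exists2 B : seq V, basis_of (K :&: A 0%N)%VS B &
    forall j, (j <= r)%N -> count [in A j] B = \dim (K :&: A j).
Proof.
elim: r A => [|r IH] A dA.
  exists (vbasis (K :&: A 0%N)%VS); first exact: vbasisP.
  move=> [|//] _; rewrite -[RHS](size_tuple (vbasis _)).
  apply/eqP; rewrite -all_count; apply/allP => x /vbasis_mem.
  by rewrite memv_cap => /andP[].
have [|B bB cB] := IH (A \o succn); first by move=> i j ij; exact: (dA i.+1 j.+1).
have sA1 j : (0 < j <= r.+1)%N -> (A j <= A 1%N)%VS by move=> ?; exact: dA.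
have sKA : (K :&: A 1%N <= K :&: A 0%N)%VS by rewrite capvS // dA.
pose D := ((K :&: A 0%N) :\: (K :&: A 1%N))%VS.
have DK0 : (D :&: (K :&: A 1%N) = 0)%VS by exact: capv_diff.
have bDB : basis_of (K :&: A 0%N)%VS (vbasis D ++ B).
  rewrite -(addv_idPl sKA) -addv_diff; apply: cat_basis => //.
    exact/directv_addP.
  exact: vbasisP.
exists (vbasis D ++ B) => // -[|j] jr.
  rewrite (size_basis (X := in_tuple _) bDB).
  apply/eqP; rewrite -all_count; apply/allP => x /(basis_mem bDB).
  by rewrite memv_cap => /andP[].
rewrite count_cat cB // (_ : count _ _ = 0)%N //; apply/eqP.
rewrite -leqn0 leqNgt -has_count; apply/hasPn => x xD /=; apply/negP => xA.
have /eqP[] := basis_not0 (vbasisP D) xD; apply/eqP.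
have xDv := vbasis_mem xD; rewrite -memv0 -DK0 memv_cap xDv memv_cap.
rewrite (subvP (sA1 _ _) _ xA) ?andbT //.
by have := subvP (diffvSl _ _) _ xDv; rewrite memv_cap => /andP[].
Qed.

Lemma card_tuple_count (T : Type) (m : nat) (B : m.-tuple T) (p : pred T) :
  #|[set i | p (tnth B i)]| = count p B.
Proof.
by rewrite cardsE cardE size_filter -[in RHS](map_tnth_enum B) count_map enumT.
Qed.

(** The count forces the vectors of [B] lying in [A] to form a basis of [K :&: A]. *)
Lemma adapted_coord0 (F : fieldType) (V : vectType F) (A K : {vspace V}) (m : nat)
    (B : m.-tuple V) (u : V) (i : 'I_m) :
  free B -> {subset B <= K} -> count [in A] B = \dim (K :&: A) ->
  u \in (K :&: A)%VS -> tnth B i \notin A -> coord B i u = 0.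
Proof.
move=> fB BK cB uKA iA.
have bB : basis_of (K :&: A)%VS (filter [in A] B).
  rewrite basisEfree filter_free // size_filter cB leqnn andbT.
  apply/span_subvP => x; rewrite mem_filter => /andP[xA xB].
  by rewrite memv_cap BK.
have /subvP ker : (<<filter [in A] B>> <= lker (linfun (coord B i : V -> F^o)))%VS.
  apply/span_subvP => x; rewrite mem_filter => /andP[/= xA /tnthP[j xj]].
  rewrite memv_ker lfunE /= xj (tnth_nth 0) coord_free //.
  case: (eqVneq j i) => [ji|_]; last exact: eqxx.
  by move: iA; rewrite -ji -xj xA.
move: uKA; rewrite -(span_basis bB) => /ker.
by rewrite memv_ker lfunE => /eqP.
Qed.

(** * The flag of a Cayley-Klein space and the level of a point *)

Section CayleyKlein.
Variables (R : realType) (n r : nat) (C : cayley_klein R n r).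
Implicit Types K : {vspace 'rV[R]_n.+1}.

Lemma ckA_vertexP (i : 'I_r.+1) (x : 'rV[R]_n.+1) :
  x \in ckA C i.+1 <->
  x \in ckA C i /\ {in ckA C i, forall y, polar_form (ckQ C i) y x = 0}.
Proof. by rewrite -ckA_vertex; exact: mem_vertex. Qed.

Lemma ckA_sub i j : (i <= j <= r.+1)%N -> (ckA C j <= ckA C i)%VS.
Proof.
elim: j => [|j IH] /andP[ij jr]; first by move: ij; rewrite leqn0 => /eqP ->.
case: (ltngtP i j.+1) ij => // [ij|->] _; last exact: subvv.
apply: subv_trans (IH _); last by rewrite -ltnS ij ltnW.
by apply/subvP => x /(ckA_vertexP (Ordinal jr))[].
Qed.

Lemma ckA_level (x : 'rV[R]_n.+1) :
  x != 0 -> exists l : 'I_r.+1, x \in ckA C l /\ x \notin ckA C l.+1.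
Proof.
move=> x0; have exA : exists k, x \notin ckA C k.
  by exists r.+1; rewrite ckA_last memv0.
have [[|k] xk kmin] := ex_minnP exA; first by rewrite ckA_first memvf in xk.
have kr : (k < r.+1)%N by apply: kmin; rewrite ckA_last memv0.
exists (Ordinal kr); split=> //=.
by apply/negPn/negP => /kmin; rewrite ltnn.
Qed.

Lemma ckA_level_inj (x : 'rV[R]_n.+1) (i j : 'I_r.+1) :
  x \in ckA C i -> x \notin ckA C i.+1 -> x \in ckA C j -> x \notin ckA C j.+1 ->
  i = j.
Proof.
have le (k m : 'I_r.+1) : x \in ckA C k -> x \notin ckA C m.+1 -> (k <= m)%N.
  move=> xk; rewrite leqNgt; apply: contraNN => mk.
  by apply: subvP xk; rewrite ckA_sub // mk ltnW.
by move=> xi xi' xj xj'; apply/val_inj/eqP; rewrite eqn_leq !le.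
Qed.

(** * Adapted bases and the construction of total polars *)

(** The range of [j] includes [r.+1], so that the count is available at the successor of every
    level. *)
Definition adapted K (B : (\dim K).-tuple 'rV[R]_n.+1) :=
  [/\ free B, {subset B <= K} &
      forall j, (j <= r.+1)%N -> count [in ckA C j] B = \dim (K :&: ckA C j)].

Lemma exists_adapted K : exists B, @adapted K B.
Proof.
have [B bB cB] := adapted_basis K ckA_sub.
rewrite ckA_first capvf in bB.
have sB : size B == \dim K by rewrite (size_basis (X := in_tuple B) bB).
exists (Tuple sB); split=> //; first exact: basis_free bB.
by move=> x; exact: basis_mem bB.
Qed.

(* phi i is only prescribed on ckA C (lev i): the freedom to choose the extension
   is what makes total polars non-unique. *)
Definition level_forms (m : nat) (B : m.-tuple 'rV[R]_n.+1) (lev : 'I_m -> 'I_r.+1)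
    (phi : 'I_m -> 'Hom('rV[R]_n.+1, R^o)) :=
  forall i, [/\ tnth B i \in ckA C (lev i), tnth B i \notin ckA C (lev i).+1 &
    {in ckA C (lev i), phi i =1 polar_form (ckQ C (lev i)) (tnth B i)}].

(** Among the nonzero coefficients of a relation pick one of maximal level and restrict to
    [ckA C (lev i)]. This space lies in the vertex of every quadric of lower level, so only the
    terms of level [lev i] survive. *)
Lemma level_forms_independent K (B : (\dim K).-tuple 'rV[R]_n.+1) lev phi
    (c : 'I_(\dim K) -> R) :
  adapted B -> level_forms B lev phi ->
  (forall y, \sum_i c i * phi i y = 0) -> forall i, c i = 0.
Proof.
move=> [fB BK cB] Bphi c0.
have [i0 ci0|z i] := pickP (fun i => c i != 0); last exact/eqP/negbFE/z.
have [i ci imax] := @arg_maxnP _ i0 (fun i => c i != 0) (fun i => lev i : nat) ci0.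
case/eqP: ci.
(* The level lev i part of the relation puts \sum_k d k *: x_k in the vertex of
   the quadric of that level. *)
pose d k := if lev k == lev i then c k else 0.
have -> : c i = d i by rewrite /d eqxx.
rewrite -(coord_sum_free d i fB).
have BA k : lev k = lev i -> tnth B k \in ckA C (lev i).
  by move=> <-; case: (Bphi k).
apply: (adapted_coord0 (A := ckA C (lev i).+1) fB BK); last first.
- by case: (Bphi i).
- rewrite memv_cap memv_suml /= => [|k _]; last first.
    by rewrite rpredZ // BK // mem_nth // size_tuple.
  apply/ckA_vertexP; split=> [|y yA].
    rewrite memv_suml // => k _; rewrite /d -tnth_nth.
    by case: eqP => [/BA kA|_]; rewrite ?scale0r ?mem0v // rpredZ.
  rewrite polar_form_sym polar_form_sum -[RHS](c0 y).
  apply: eq_bigr => k _; rewrite /d -tnth_nth.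
  have [_ _ phik] := Bphi k.
  have [E|E] := eqVneq (lev k) (lev i); first by rewrite E in phik; rewrite phik.
  rewrite mul0r; have [->|ck] := eqVneq (c k) 0; first by rewrite mul0r.
  have ki : (lev k < lev i)%N by rewrite ltn_neqAle E; exact: imax.
  have yk : y \in ckA C (lev k).+1.
    by apply: subvP yA; rewrite ckA_sub // ki ltnW.
  have [kA _ _] := Bphi k; have [yA' y0] := iffLR (ckA_vertexP _ _) yk.
  by rewrite phik // y0 // mulr0.
- by rewrite cB.
Qed.

(** Every choice of extensions is allowed, which gives existence and also the second total polar of
    a non-regular [K]. *)
Lemma level_forms_total_polar K (B : (\dim K).-tuple 'rV[R]_n.+1) lev phi :
  adapted B -> level_forms B lev phi ->
  total_polar C K (\bigcap_(i < \dim K) lker (phi i))%VS.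
Proof.
move=> aB Bphi; have indep := level_forms_independent aB Bphi.
have dimV : \dim {:'rV[R]_n.+1} = n.+1 by rewrite dimvf /dim /= mul1n.
have [fB BK cB] := aB.
apply: Or33; split.
  have /= := @dim_bigcap_lker _ _ fullv _ phi; rewrite capfv dimV => d.
  apply/eqP; rewrite -(eqn_add2r (\dim K)) d => [|c c0].
    by rewrite subnK // -[leqRHS]dimV dimvS ?subvf.
  by apply: indep => y; rewrite c0 ?memvf.
exists B, (fun i => lker (phi i)); split=> //.
- by split=> // i; rewrite BK ?mem_tnth.
- by move=> j; rewrite -cB ?(card_tuple_count B [in ckA C j]) // ltnW.
- move=> i; have [iA iA' phii] := Bphi i; split; last first.
    exists (lev i); split=> //; apply/subvP => x /mem_polar[xA x0].
    by rewrite memv_ker phii // x0 // memv_cap iA memv_line.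
  (* The kernel of [phi i] is a hyperplane: the dimension count is applied to this single form,
     whose independence follows from relations supported at [i]. *)
  have /= := @dim_bigcap_lker _ _ fullv 1 (fun=> phi i).
  rewrite capfv dimV big_ord1 addn1 => d; apply: succn_inj; apply: d.
  move=> c c0 j; rewrite ord1.
  have := indep (fun k => if k == i then c ord0 else 0) _ i; rewrite eqxx; apply.
  move=> y; rewrite (bigD1 i) //= eqxx big1 ?addr0 => [|k /negPf ->]; last first.
    by rewrite mul0r.
  by have := c0 y (memvf y); rewrite big_ord1.
- exists [tuple phi i | i < \dim K]; split=> [|i]; last by rewrite tnth_mktuple.
  apply/freeP => k k0; apply: indep => y.
  have := congr1 (fun f : 'Hom('rV[R]_n.+1, R^o) => f y) k0.
  rewrite sum_lfunE zero_lfunE => {2}<-; apply: eq_bigr => i _.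
  by rewrite -tnth_nth tnth_mktuple scale_lfunE.
Qed.

Lemma exists_level_forms K (B : (\dim K).-tuple 'rV[R]_n.+1) :
  adapted B -> exists lev : 'I_(\dim K) -> 'I_r.+1,
    level_forms B lev (fun i => polar_form (ckQ C (lev i)) (tnth B i)).
Proof.
move=> [fB _ _].
have lB i : exists l : 'I_r.+1, tnth B i \in ckA C l /\ tnth B i \notin ckA C l.+1.
  by apply: ckA_level; apply: free_not0 fB _; exact: mem_tnth.
have [lev levP] := fin_all_exists lB.
by exists lev => i; have [? ?] := levP i; split.
Qed.

(** * Dimension of the polar, regularity and uniqueness *)

Lemma mem_polar_spanning K (l : 'I_r.+1) (B : (\dim K).-tuple 'rV[R]_n.+1) z :
  free B -> {subset B <= K} -> count [in ckA C l] B = \dim (K :&: ckA C l) ->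
  z \in ckA C l ->
  (forall i, tnth B i \in ckA C l -> polar_form (ckQ C l) (tnth B i) z = 0) ->
  z \in polar (ckQ C l) (K :&: ckA C l).
Proof.
move=> fB BK cB zA z0; apply/mem_polar; split=> // y /memv_capP[_ yKA].
have bB : basis_of K B.
  by rewrite basisEfree fB size_tuple leqnn andbT; apply/span_subvP.
have /memv_capP[yK _] := yKA.
rewrite (coord_basis bB yK) polar_form_sum big1 // => i _; rewrite -tnth_nth.
have [iA|iA] := boolP (tnth B i \in ckA C l); first by rewrite z0 // mulr0.
by rewrite (adapted_coord0 fB BK cB) ?mul0r.
Qed.

(** The level in [regular] is determined by [K], since the flag is decreasing. *)
Lemma regularE K (l : 'I_r.+1) :
  (K :&: ckA C l != 0)%VS -> (K :&: ckA C l.+1 = 0)%VS ->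
  regular C K <-> (K + ckA C l = fullv)%VS.
Proof.
move=> Kl Kl1; split=> [[m [Km Km1 <-]]|]; last by exists l.
have lt0 (i j : 'I_r.+1) : (K :&: ckA C i.+1 = 0)%VS ->
    (K :&: ckA C j != 0)%VS -> (j <= i)%N.
  move=> Ki; apply: contraNT; rewrite -ltnNge => ij.
  by rewrite -subv0 -Ki capvS // ckA_sub // ij ltnW.
by congr (K + ckA C _)%VS; apply/eqP; rewrite eqn_leq !lt0.
Qed.

(** Grassmann's formula combined with [dim_polar]: the vertex [ckA C l.+1] misses [K]. *)
Lemma dim_polar_cap K (l : 'I_r.+1) : (K :&: ckA C l.+1 = 0)%VS ->
  (\dim (K + ckA C l) =
   \dim K + \dim (polar (ckQ C l) (K :&: ckA C l)))%N.
Proof.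
move=> Kl1; apply/eqP; rewrite -(eqn_add2r (\dim (K :&: ckA C l))).
rewrite dimv_sum_cap -addnA dim_polar ?capvSr // ckA_vertex.
by apply/eqP; rewrite -subv0 -Kl1 capvS // capvSl.
Qed.

Lemma dim_total_polar K T :
  K != 0%VS -> total_polar C K T -> (\dim K + \dim T = \dim {:'rV[R]_n.+1})%N.
Proof.
have dimV : \dim {:'rV[R]_n.+1} = n.+1 by rewrite dimvf /dim /= mul1n.
move=> K0 [[-> ->]|[/eqP E]|[-> _]].
- by rewrite dimv0 addn0.
- by rewrite E in K0.
- by rewrite subnKC ?dimV // -[leqRHS]dimV dimvS ?subvf.
Qed.

Lemma polar_sub_total_polar K (l : 'I_r.+1) T :
  K != 0%VS -> (K :&: ckA C l.+1 = 0)%VS -> (K + ckA C l = fullv)%VS ->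
  total_polar C K T -> (polar (ckQ C l) (K :&: ckA C l) <= T)%VS.
Proof.
move=> K0 Kl1 KA [[E ->]|[/eqP E]|[_ [B [H [[fB BK] _ HB _ ->]]]]].
(* Here [K] is the whole space and [T] is zero, so the dimension formula must show that the polar is
   zero. *)
- rewrite subv0 -dimv_eq0 -(eqn_add2l (\dim K)) -dim_polar_cap // KA E.
  by rewrite addn0.
- by rewrite E in K0.
apply/subv_bigcapP => i _; have [_ [m [iA iA' /subvP]]] := HB i.
move=> sH; apply/subvP => z zP; apply: sH.
have B0 : tnth B i != 0 by apply: free_not0 fB _; exact: mem_tnth.
(* If [m = l], conjugacy to [K :&: ckA C l] includes conjugacy to the basis vector. If [m < l], then
   [ckA C l] lies in the vertex of the quadric of level [m]. *)
have ml : (m <= l)%N.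
  rewrite leqNgt; apply: contraNN B0 => lm.
  rewrite -memv0 -Kl1 memv_cap BK ?mem_tnth //= (subvP (ckA_sub _) _ iA) //.
  by rewrite lm ltnW.
have [zA z0] := iffLR (mem_polar _ _ _) zP.
apply/mem_polar; move: ml; rewrite leq_eqVlt => /orP[/eqP/val_inj E|ml].
  subst m; split=> // y /memv_capP[_ /vlineP[k ->]].
  rewrite polar_form_sym linearZ /= polar_form_sym z0 ?scaler0 //.
  by rewrite !memv_cap iA BK ?mem_tnth.
have zm : z \in ckA C m.+1 by apply: subvP zA; rewrite ckA_sub // ml ltnW.
have [zAm zm0] := iffLR (ckA_vertexP _ _) zm.
by split=> // y /memv_capP[yA _]; exact: zm0.
Qed.

(** The total polar is left unnamed, so that the result serves both equivalences. *)
Lemma total_polar_unique_regular K (l : 'I_r.+1) :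
  (K :&: ckA C l != 0)%VS -> (K :&: ckA C l.+1 = 0)%VS ->
  (exists! T, total_polar C K T) -> (K + ckA C l = fullv)%VS.
Proof.
move=> Kl Kl1 [T0 [_ T0uniq]].
have [B aB] := exists_adapted K; have [lev Bphi] := exists_level_forms aB.
set phi := fun i => polar_form _ _ in Bphi.
set T := (\bigcap_(i < \dim K) lker (phi i))%VS.
have TK : total_polar C K T := level_forms_total_polar aB Bphi.
have [fB BK cB] := aB.
have K0 : K != 0%VS by apply: contraNneq Kl => ->; rewrite cap0v.
have phi0 z i : z \in T -> phi i z = 0.
  move=> zT; have : z \in lker (phi i).
    by apply: subvP zT; exact: (@bigcapv_inf _ _ _ i).
  by rewrite memv_ker => /eqP.
have levE i : tnth B i \in ckA C l -> lev i = l.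
  move=> iA; have [iA1 iA2 _] := Bphi i; apply: ckA_level_inj iA1 iA2 iA _.
  apply: contraNN (free_not0 fB (mem_tnth i B)) => iA'.
  by rewrite -memv0 -Kl1 memv_cap BK ?mem_tnth.
have cBl : count [in ckA C l] B = \dim (K :&: ckA C l) by rewrite cB // ltnW.
(* If [T] lies in [ckA C l], it lies in the polar, whose dimension is then large enough for
   [K + ckA C l] to be everything. *)
have [TA|/subvPn[t tT tA]] := boolP (T <= ckA C l)%VS.
  apply/eqP; rewrite eqEdim subvf dim_polar_cap //.
  rewrite -(dim_total_polar K0 TK) leq_add2l dimvS //.
  apply/subvP => z zT; apply: (mem_polar_spanning fB BK cBl) => [|i /levE <-].
    exact: subvP TA _ zT.
  exact: phi0.
have [psi /subvP psiA psit] := separating_form tA.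
have [i0 lev0] : exists i, lev i = l.
  have : has [in ckA C l] B by rewrite has_count cBl lt0n dimv_eq0.
  by case/hasP => x /tnthP[i ->] /levE; exists i.
(* Since [psi] vanishes on [ckA C l], the altered forms still define a total polar, but [t] is no
   longer in it. *)
pose phi' i := if i == i0 then phi i + psi else phi i.
have Bphi' : level_forms B lev phi'.
  move=> i; have [iA iA' phii] := Bphi i; split=> // y yA.
  rewrite /phi'; case: eqP => // E; rewrite add_lfunE phii //.
  have : y \in lker psi by apply: psiA; rewrite -lev0 -E.
  by rewrite memv_ker => /eqP ->; rewrite addr0.
have E := etrans (esym (T0uniq _ TK)) (T0uniq _ (level_forms_total_polar aB Bphi')).
case/eqP: psit.
have : t \in lker (phi' i0).
  by move: tT; rewrite E; apply: subvP; exact: (@bigcapv_inf _ _ _ i0).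
by rewrite memv_ker /phi' eqxx add_lfunE phi0 // add0r => /eqP.
Qed.

End CayleyKlein.

Theorem proposition3p11 (R : realType) (n r : nat) (C : cayley_klein R n r)
    (K : {vspace 'rV[R]_n.+1}) (l : 'I_r.+1)
    (hKl : (K :&: ckA C l)%VS <> 0%VS)
    (hKl1 : (K :&: ckA C l.+1)%VS = 0%VS) :
  (unique (total_polar C K) (polar (ckQ C l) (K :&: ckA C l)%VS)
     <-> regular C K) /\
  ((exists! T : {vspace 'rV[R]_n.+1}, total_polar C K T) <-> regular C K).
Proof.
move/eqP: hKl => Kl.
have K0 : K != 0%VS by apply: contraNneq Kl => ->; rewrite cap0v.
have regE := regularE Kl hKl1.
suff uniqP : regular C K ->
    unique (total_polar C K) (polar (ckQ C l) (K :&: ckA C l)).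
  have regP : (exists! T, total_polar C K T) -> regular C K.
    by move=> /(total_polar_unique_regular Kl hKl1)/regE.
  split; split=> // uP; last first.
    by exists (polar (ckQ C l) (K :&: ckA C l)); exact: uniqP.
  by apply: regP; exists (polar (ckQ C l) (K :&: ckA C l)).
move=> /regE KA.
(* Inclusion together with equality of dimensions. *)
have polarE T : total_polar C K T -> polar (ckQ C l) (K :&: ckA C l) = T.
  move=> TK; apply/eqP; rewrite eqEdim polar_sub_total_polar //=.
  by rewrite -(leq_add2l (\dim K)) (dim_total_polar K0 TK) -dim_polar_cap // KA.
have [B aB] := exists_adapted C K; have [lev Bphi] := exists_level_forms aB.
have TK := level_forms_total_polar aB Bphi.
by split=> //; rewrite (polarE _ TK).
Qed.
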